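(* Let $\mathbf{A}\in\mathbb{R}^{n\times n}$ be symmetric, let $P$ be the number of processors, arranged in a $\sqrt{P}\times\sqrt{P}$ grid, and suppose $\sqrt{P}$ and $b=n/\sqrt{P}$ are integers. Assume that $O(k^3)$ algorithms are used for $k\times k$ (local) matrix multiplication and for diagonalization of $k\times k$ symmetric matrices. Then one sweep of 2D parallel Jacobi (the algorithm described in the context) has complexity $$\alpha\cdot O\!\left(\sqrt{P}\log P\right)+\beta\cdot O\!\left(\frac{n^2}{\sqrt{P}}\right)+\gamma\cdot O\!\left(\frac{n^3}{P}\right).$$
   Context: **Cost model.** On a distributed-memory machine with $P$ processors, for a parallel algorithm let $S$ be the number of messages sent between processors along the critical path (the longest chain of serially dependent operations), $W$ the maximum number of words communicated by any processor along the critical path, and $F$ the maximum number of floating-point operations performed by any processor along the critical path. The cost is $\alpha S+\beta W+\gamma F$, where $\alpha,\beta,\gamma$ are the times per message, per word and per flop. ''Complexity $\alpha\cdot O(f)+\beta\cdot O(g)+\gamma\cdot O(h)$'' means $S=O(f)$, $W=O(g)$, $F=O(h)$. Communication and computation do not overlap on a processor and there is no contention across the grid. A point-to-point send of $w$ words costs $O(1)$ messages and $O(w)$ words. A broadcast of $w$ words from a root to $p$ processors (with $w\ge p$) costs $\alpha\cdot 2\log_2 p+\beta\cdot 2w$. **Data layout.** Processors are labelled $\mathrm{Proc}(I,J)$, $1\le I,J\le\sqrt{P}$. $\mathrm{Proc}(I,J)$ owns the $b\times b$ block $\mathbf{A}_{IJ}=\mathbf{A}((I-1)b+1:Ib,\,(J-1)b+1:Jb)$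 of $\mathbf{A}$ and the corresponding block $\mathbf{Q}_{IJ}$ of an orthogonal matrix $\mathbf{Q}\in\mathbb{R}^{n\times n}$ of accumulated approximate eigenvectors (initially the identity if not supplied). **Index list.** $L$ is a list of $\sqrt{P}$ groups; for $K=0,\dots,\sqrt{P}-1$, the corresponding group consists of all pairs $(I,J)$ with $1\le I<J\le\sqrt{P}$ and $I+J\equiv K \pmod{\sqrt{P}}$. Within a group, distinct pairs are disjoint as two-element sets. **One sweep of 2D parallel Jacobi.** The groups $g\in L$ are processed serially, one after the other; for each $g$, all pairs $(I,J)\in g$ are processed in parallel as follows. 1. $\mathrm{Proc}(I,I)$ and $\mathrm{Proc}(J,J)$ send $\mathbf{A}_{II}$ and $\mathbf{A}_{JJ}$ to $\mathrm{Proc}(I,J)$. 2. $\mathrm{Proc}(I,J)$ locally computes an (exact or approximate) diagonalization $\begin{pmatrix}\mathbf{A}_{II}&\mathbf{A}_{IJ}\\ \mathbf{A}_{JI}&\mathbf{A}_{JJ}\end{pmatrix}=\mathbf{V}\mathbf{D}\mathbf{V}^T$ of the $2b\times2b$ subproblem, and partitions $\mathbf{V}=(\mathbf{V}_{ij})$, $\mathbf{D}=(\mathbf{D}_{ij})$, $i,j\in\{1,2\}$, into $b\times b$ blocks. 3. $\mathrm{Proc}(I,J)$ sends $\mathbf{V}_{11},\mathbf{V}_{21},\mathbf{D}_{11}$ to $\mathrm{Proc}(I,I)$; $\mathbf{V}_{12},\mathbf{V}_{22},\mathbf{D}_{22}$ to $\mathrm{Proc}(J,J)$; and $\mathbf{V}_{11},\mathbf{V}_{21},\mathbf{V}_{22},\mathbf{D}_{21}$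 to $\mathrm{Proc}(J,I)$. The blocks $\mathbf{A}_{II},\mathbf{A}_{IJ},\mathbf{A}_{JI},\mathbf{A}_{JJ}$ are overwritten by $\mathbf{D}_{11},\mathbf{D}_{12},\mathbf{D}_{21},\mathbf{D}_{22}$. 4. For all $K$ in parallel: if $K\ne I,J$, $\mathrm{Proc}(I,K)$ and $\mathrm{Proc}(J,K)$ exchange $\mathbf{A}_{IK}\leftrightarrow\mathbf{A}_{JK}$, and $\mathrm{Proc}(K,I)$ and $\mathrm{Proc}(K,J)$ exchange $\mathbf{A}_{KI}\leftrightarrow\mathbf{A}_{KJ}$; for every $K$, $\mathrm{Proc}(K,I)$ and $\mathrm{Proc}(K,J)$ exchange $\mathbf{Q}_{KI}\leftrightarrow\mathbf{Q}_{KJ}$. 5. $\mathrm{Proc}(I,I)$ broadcasts $\mathbf{V}_{11},\mathbf{V}_{21}$ to $\mathrm{Proc}(I,K)$ and $\mathrm{Proc}(K,I)$ for all $K\ne I,J$; $\mathrm{Proc}(J,J)$ broadcasts $\mathbf{V}_{12},\mathbf{V}_{22}$ to $\mathrm{Proc}(J,K)$ and $\mathrm{Proc}(K,J)$ for all $K\neq I,J$. 6. For all $K$ in parallel, by local matrix multiplications: if $K\ne I,J$, $\mathrm{Proc}(I,K)$ sets $\mathbf{A}_{IK}\leftarrow\mathbf{V}_{11}^T\mathbf{A}_{IK}+\mathbf{V}_{21}^T\mathbf{A}_{JK}$, $\mathrm{Proc}(J,K)$ sets $\mathbf{A}_{JK}\leftarrow\mathbf{V}_{12}^T\mathbf{A}_{IK}+\mathbf{V}_{22}^T\mathbf{A}_{JK}$,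 $\mathrm{Proc}(K,I)$ sets $\mathbf{A}_{KI}\leftarrow\mathbf{A}_{KI}\mathbf{V}_{11}+\mathbf{A}_{KJ}\mathbf{V}_{21}$, $\mathrm{Proc}(K,J)$ sets $\mathbf{A}_{KJ}\leftarrow\mathbf{A}_{KI}\mathbf{V}_{12}+\mathbf{A}_{KJ}\mathbf{V}_{22}$; for every $K$, $\mathrm{Proc}(K,I)$ sets $\mathbf{Q}_{KI}\leftarrow\mathbf{Q}_{KI}\mathbf{V}_{11}+\mathbf{Q}_{KJ}\mathbf{V}_{21}$ and $\mathrm{Proc}(K,J)$ sets $\mathbf{Q}_{KJ}\leftarrow\mathbf{Q}_{KI}\mathbf{V}_{12}+\mathbf{Q}_{KJ}\mathbf{V}_{22}$ (right-hand sides use the old values). *)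

(* Defs.v *)
From mathcomp Require Import all_boot all_order all_algebra.
From mathcomp Require Import reals exp.

Set Implicit Arguments.
Unset Strict Implicit.
Unset Printing Implicit Defensive.

Import Order.TTheory GRing.Theory Num.Theory.
Local Open Scope ring_scope.

Definition log2 (R : realType) (x : R) : R := ln x / ln 2.

(* [bcast_msgs p w], [bcast_words p w]: broadcast of w words to p processors. *)
Record comm_model (R : realType) := CommModel {
  send_msgs : nat -> R;
  send_words : nat -> R;
  bcast_msgs : nat -> nat -> R;
  bcast_words : nat -> nat -> R }.

(* The formula 2 log2 p, 2 w is the cost of a broadcast with p <= w.  A
   broadcast of fewer words than there are recipients (which occurs in a sweep
   when b ^ 2 < sqrt P - 2) is only required to be of the same order, as it is
   for a binary tree of sends, in which every processor communicates at most
   3 w words. *)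
Definition comm_costs (R : realType) (M : comm_model R) : Prop :=
  exists c : R,
  [/\ forall w, 0 <= send_msgs M w <= c,
      forall w, 0 <= send_words M w <= c * w%:R,
      forall p w, (0 < p <= w)%N ->
        bcast_msgs M p w = 2 * log2 p%:R /\ bcast_words M p w = 2 * w%:R
    & forall p w, (w < p)%N ->
        0 <= bcast_msgs M p w <= c * log2 p%:R /\
        0 <= bcast_words M p w <= c * w%:R ].

(* [mm_flops k]: flops of the multiplication of two k x k matrices.
   [diag X]: the pair (V, D) computed from X; its flop count may depend on X. *)
Record kernels (R : realType) := Kernels {
  mm_flops : nat -> nat;
  diag : forall k : nat, 'M[R]_k -> 'M[R]_k * 'M[R]_k;
  diag_flops : forall k : nat, 'M[R]_k -> nat }.

(* D need not be diagonal: the diagonalization may be approximate. *)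
Definition diagonalizes (R : realType) (lk : kernels R) : Prop :=
  forall (k : nat) (X : 'M[R]_k), X^T = X ->
    let V := (diag lk X).1 in let D := (diag lk X).2 in
    V^T *m V = 1%:M /\ X = V *m D *m V^T.

Definition cubic_mm (R : realType) (lk : kernels R) : Prop :=
  exists c : nat, forall k : nat, (mm_flops lk k <= c * k ^ 3)%N.

Definition cubic_diag (R : realType) (lk : kernels R) : Prop :=
  exists c : nat, forall (k : nat) (X : 'M[R]_k), X^T = X ->
    (diag_flops lk X <= c * k ^ 3)%N.

(* Indices start at 0: (I, J) stands for Proc(I+1, J+1). *)
Definition proc (q : nat) := ('I_q * 'I_q)%type.

Inductive op (R : realType) (q b : nat) :=
| Send of proc q & proc q & seq 'M[R]_b
| Bcast of proc q & seq (proc q) & seq 'M[R]_b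
| Local of proc q & nat.

Section Cost.
Variables (R : realType) (M : comm_model R) (q b : nat).
Implicit Types (o : op R q b) (p : proc q).

Definition involves p o : bool :=
  match o with
  | Send r s _ => (p == r) || (p == s)
  | Bcast r ss _ => (p == r) || (p \in ss)
  | Local r _ => p == r
  end.

Definition nwords (X : seq 'M[R]_b) : nat := (size X * b ^ 2)%N.

Definition op_msgs o : R :=
  match o with
  | Send _ _ X => send_msgs M (nwords X)
  | Bcast _ ss X => bcast_msgs M (size ss) (nwords X)
  | Local _ _ => 0
  end.

Definition op_words o : R :=
  match o with
  | Send _ _ X => send_words M (nwords X)
  | Bcast _ ss X => bcast_words M (size ss) (nwords X)
  | Local _ _ => 0
  end.

Definition op_flops o : R := if o is Local _ f then f%:R else 0.

(* A step lists operations that are processed in parallel; the steps of a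
   program are processed serially.  Within a step, the operations involving
   the same processor are serialized, since a processor does one thing at a
   time, and there is no other contention.  Hence a chain of serially dependent
   operations is described by one processor per step, and consists of
   the operations of each step which involve the processor chosen there.  A
   broadcast is not an indivisible event: two broadcasts of a step may overlap
   in time even if they have recipients in common, and both are charged
   to every common recipient. *)
Definition step := seq (op R q b).
Definition program := seq step.

Definition load (f : op R q b -> R) (s : step) p : R :=
  \sum_(o <- s | involves p o) f o.

Definition along_critical_path (f : op R q b -> R) (pr : program) : R :=
  \big[Num.max/0]_(c : {ffun 'I_(size pr) -> proc q})
    \sum_(t < size pr) load f (nth [::] pr t) (c t).

Definition S_cost (pr : program) : R := along_critical_path op_msgs pr.
Definition W_cost (pr : program) : R := along_critical_path op_words pr.
Definition F_cost (pr : program) : R := along_critical_path op_flops pr.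

End Cost.

Section Jacobi.
Variables (R : realType) (lk : kernels R) (q b : nat).

Definition blocks := 'I_q -> 'I_q -> 'M[R]_b.

Lemma block_index_proof (I : 'I_q) (i : 'I_b) : (I * b + i < q * b)%N.
Proof.
apply: (@leq_trans (I.+1 * b)); last by rewrite leq_mul2r ltn_ord orbT.
by rewrite mulSn addnC ltn_add2r.
Qed.

Definition block_index (I : 'I_q) (i : 'I_b) : 'I_(q * b) :=
  Ordinal (block_index_proof I i).

Definition blocks_of (X : 'M[R]_(q * b)) : blocks :=
  fun I J => \matrix_(i, j) X (block_index I i) (block_index J j).

(* The congruence is on the labels I+1, J+1, which start at 1. *)
Definition group (K : nat) : seq (proc q) :=
  [seq x : proc q <- enum {: proc q} |
    (x.1 < x.2)%N && (x.1.+1 + x.2.+1 == K %[mod q])].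

Definition index_list : seq (seq (proc q)) := [seq group K | K <- iota 0 q].

(* A and Q, in this order. *)
Definition state := (blocks * blocks)%type.

Definition subproblem (A : blocks) (I J : 'I_q) : 'M[R]_(b + b) :=
  block_mx (A I I) (A I J) (A J I) (A J J).

Definition others (I J : 'I_q) : seq 'I_q :=
  [seq K <- enum 'I_q | (K != I) && (K != J)].

Definition exchange (r s : proc q) (X Y : 'M[R]_b) : step R q b :=
  [:: Send r s [:: X]; Send s r [:: Y]].

Definition broadcast (r : proc q) (ss : seq (proc q)) (X : seq 'M[R]_b) :
    step R q b :=
  if ss is [::] then [::] else [:: Bcast r ss X].

Definition cross (I : 'I_q) (Ks : seq 'I_q) : seq (proc q) :=
  [seq (I, K) | K <- Ks] ++ [seq (K, I) | K <- Ks].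

Definition send_diag_blocks (A : blocks) (x : proc q) : step R q b :=
  let I := x.1 in let J := x.2 in
  [:: Send (I, I) (I, J) [:: A I I]; Send (J, J) (I, J) [:: A J J]].

Definition solve_subproblem (A : blocks) (x : proc q) : step R q b :=
  let I := x.1 in let J := x.2 in
  [:: Local R b (I, J) (diag_flops lk (subproblem A I J))].

Definition send_results (A : blocks) (x : proc q) : step R q b :=
  let I := x.1 in let J := x.2 in
  let: (V, D) := diag lk (subproblem A I J) in
  [:: Send (I, J) (I, I) [:: ulsubmx V; dlsubmx V; ulsubmx D];
      Send (I, J) (J, J) [:: ursubmx V; drsubmx V; drsubmx D];
      Send (I, J) (J, I) [:: ulsubmx V; dlsubmx V; drsubmx V; dlsubmx D]].

Definition exchange_blocks (A Q : blocks) (x : proc q) : step R q b :=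
  let I := x.1 in let J := x.2 in
  flatten [seq exchange (I, K) (J, K) (A I K) (A J K)
            ++ exchange (K, I) (K, J) (A K I) (A K J) | K <- others I J]
  ++ flatten [seq exchange (K, I) (K, J) (Q K I) (Q K J) | K <- enum 'I_q].

Definition broadcast_vectors (A : blocks) (x : proc q) : step R q b :=
  let I := x.1 in let J := x.2 in
  let V := (diag lk (subproblem A I J)).1 in
  broadcast (I, I) (cross I (others I J)) [:: ulsubmx V; dlsubmx V]
  ++ broadcast (J, J) (cross J (others I J)) [:: ursubmx V; drsubmx V].

(* Two b x b products and one addition. *)
Definition update_flops : nat := (2 * mm_flops lk b + b ^ 2)%N.

Definition update_blocks (x : proc q) : step R q b :=
  let I := x.1 in let J := x.2 in
  let upd p := Local R b p update_flops in
  flatten [seq [:: upd (I, K); upd (J, K); upd (K, I); upd (K, J)]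
            | K <- others I J]
  ++ flatten [seq [:: upd (K, I); upd (K, J)] | K <- enum 'I_q].

Definition group_program (st : state) (g : seq (proc q)) : program R q b :=
  let: (A, Q) := st in
  [:: flatten [seq send_diag_blocks A x | x <- g];
      flatten [seq solve_subproblem A x | x <- g];
      flatten [seq send_results A x | x <- g];
      flatten [seq exchange_blocks A Q x | x <- g];
      flatten [seq broadcast_vectors A x | x <- g];
      flatten [seq update_blocks x | x <- g]].

Definition col_update (V : 'M[R]_(b + b)) (I J : 'I_q) (X : blocks) : blocks :=
  fun r c =>
    if c == I then X r I *m ulsubmx V + X r J *m dlsubmx V
    else if c == J then X r I *m ursubmx V + X r J *m drsubmx V
    else X r c.

Definition row_update (V : 'M[R]_(b + b)) (I J : 'I_q) (X : blocks) : blocks :=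
  fun r c =>
    if r == I then (ulsubmx V)^T *m X I c + (dlsubmx V)^T *m X J c
    else if r == J then (ursubmx V)^T *m X I c + (drsubmx V)^T *m X J c
    else X r c.

Definition overwrite (D : 'M[R]_(b + b)) (I J : 'I_q) (X Y : blocks) : blocks :=
  fun r c =>
    if r == I then
      if c == I then ulsubmx D else if c == J then ursubmx D else X r c
    else if r == J then
      if c == I then dlsubmx D else if c == J then drsubmx D else X r c
    else Y r c.

Definition pair_effect (st : state) (x : proc q) : state :=
  let: (A, Q) := st in let I := x.1 in let J := x.2 in
  let: (V, D) := diag lk (subproblem A I J) in
  (overwrite D I J (row_update V I J A) (col_update V I J A),
   col_update V I J Q).

(* The pairs of a group are disjoint, so that their subproblems do not
   interfere and their row and column updates commute: the joint effect of the
   pairs is the composite of their individual effects, in any order. *)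
Definition group_effect (st : state) (g : seq (proc q)) : state :=
  foldl pair_effect st g.

Fixpoint run (st : state) (gs : seq (seq (proc q))) : program R q b :=
  if gs is g :: gs' then group_program st g ++ run (group_effect st g) gs'
  else [::].

Definition jacobi_sweep (A Q : 'M[R]_(q * b)) : program R q b :=
  run (blocks_of A, blocks_of Q) index_list.

End Jacobi.

(* Main.v *)
(* A sweep has 6 q steps.  An operation of the pair (I, J) only involves
   processors whose row or column is I or J, and the pairs of a group are
   disjoint, so at most two pairs of a group concern a given processor (u, v).
   Each of them charges it with at most 12 operations of a step, because only
   the indices K = u and K = v matter among all K.  Hence a processor takes part
   in at most 24 operations per step, each of O(log q) messages, O(b ^ 2) words
   and O(b ^ 3) flops.  For the flops of the diagonalizations one needs that the
   subproblems stay symmetric: D = V^T X V is symmetric with X, so each pair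
   effect preserves the symmetry of A. *)

Require Import Defs.
From mathcomp Require Import all_boot all_order all_algebra.
From mathcomp Require Import reals exp.
From mathcomp Require Import ring lra.
Import Order.TTheory GRing.Theory Num.Theory.
Local Open Scope ring_scope.

(** * Counting in flattened lists *)

Lemma count_flatten_le (T : eqType) (U : Type) (a : pred U) (F : T -> seq U)
    (r : pred T) (k : nat) (s : seq T) :
  (forall x, x \in s -> (count a (F x) <= r x * k)%N) ->
  (count a (flatten [seq F x | x <- s]) <= count r s * k)%N.
Proof.
elim: s => [//|x s IHs] ha; rewrite /= count_cat mulnDl leq_add //.
  by rewrite ha ?mem_head.
by apply: IHs => y ys; rewrite ha // inE ys orbT.
Qed.

Lemma count_orb_le (T : Type) (a1 a2 : pred T) (s : seq T) :
  (count (fun x => a1 x || a2 x) s <= count a1 s + count a2 s)%N.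
Proof. by rewrite -count_predUI leq_addr. Qed.

Lemma count_pred2_le (T : eqType) (u v : T) (s : seq T) :
  uniq s -> (count (pred2 u v) s <= 2)%N.
Proof.
move=> us; have := count_orb_le _ (pred1 u) (pred1 v) s.
by move/leq_trans; apply; rewrite !count_uniq_mem // (leq_add (leq_b1 _) (leq_b1 _)).
Qed.

Lemma all_flatten_map (T : eqType) (U : Type) (a : pred U) (F : T -> seq U)
    (s : seq T) :
  {in s, forall x, all a (F x)} -> all a (flatten [seq F x | x <- s]).
Proof.
elim: s => [//|x s IHs] h; rewrite /= all_cat h ?mem_head //=.
by apply: IHs => y ys; rewrite h // inE ys orbT.
Qed.

(** * Symmetry of the subproblems throughout a sweep *)

Section Symmetry.
Context {R : realType} {q b : nat}.
Implicit Types (A Q : @blocks R q b).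

Definition block_sym A : Prop := forall I J, (A I J)^T = A J I.

Lemma block_sym_blocks_of (X : 'M[R]_(q * b)) :
  X^T = X -> block_sym (blocks_of X).
Proof. by move=> hX I J; apply/matrixP=> i j; rewrite !mxE -{1}hX mxE. Qed.

Lemma subproblem_sym A (I J : 'I_q) :
  block_sym A -> (subproblem A I J)^T = subproblem A I J.
Proof. by move=> hA; rewrite tr_block_mx !hA. Qed.

Lemma diagonalizes_sym (lk : kernels R) (k : nat) (X : 'M[R]_k) :
  diagonalizes lk -> X^T = X -> (diag lk X).2^T = (diag lk X).2.
Proof.
move=> hd hX; have [VV XE] := hd k X hX.
set V := (diag lk X).1 in VV XE; set D := (diag lk X).2 in XE *.
have -> : D = V^T *m X *m V by rewrite XE !mulmxA VV mul1mx -mulmxA VV mulmx1.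
by rewrite !trmx_mul trmxK hX mulmxA.
Qed.

(** The transpose of [col_update] at (r, c) is [row_update] at (c, r), and [overwrite] uses one or
    the other according to whether the row belongs to the pair. The four remaining blocks are those
    of the symmetric D. *)
Lemma pair_effect_sym (lk : kernels R) A Q (x : proc q) :
  diagonalizes lk -> block_sym A ->
  block_sym (pair_effect lk (A, Q) x).1.
Proof.
case: x => I J /= hd hA; have hS := subproblem_sym A I J hA.
have := @diagonalizes_sym lk _ _ hd hS.
case: (diag lk _) => V D /= hD.
have hul : (ulsubmx D)^T = ulsubmx D by rewrite trmx_ulsub hD.
have hur : (ursubmx D)^T = dlsubmx D by rewrite trmx_ursub hD.
have hdl : (dlsubmx D)^T = ursubmx D by rewrite trmx_dlsub hD.
have hdr : (drsubmx D)^T = drsubmx D by rewrite trmx_drsub hD.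
move=> r c; rewrite /overwrite /row_update /col_update.
by case: (r == I); case: (c == I); case: (r == J); case: (c == J);
  rewrite // linearD /= !trmx_mul ?trmxK !hA.
Qed.

Lemma group_effect_sym (lk : kernels R) (st : state R q b) g :
  diagonalizes lk -> block_sym st.1 -> block_sym (group_effect lk st g).1.
Proof.
move=> hd; elim: g st => [//|x g IHg] [A Q] hA.
exact: (IHg (pair_effect lk (A, Q) x) (pair_effect_sym lk A Q x hd hA)).
Qed.

End Symmetry.

(** * Operations per processor in one step *)

Section Contention.
Context {R : realType} {q b : nat}.
Implicit Types (p x : proc q) (A Q : @blocks R q b).

Definition meets p : pred (proc q) :=
  fun x => pred2 x.1 x.2 p.1 || pred2 x.1 x.2 p.2.

Lemma group_lt (K : nat) : {in group q K, forall x, (x.1 < x.2)%N}.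
Proof. by move=> x; rewrite mem_filter => /andP[/andP[]]. Qed.

(** The congruence fixes the partner of u modulo q, hence as an index below q, and the order of the
    pair is forced by I < J. *)
Lemma count_group_index_le (K : nat) (u : 'I_q) :
  (count (fun x => pred2 x.1 x.2 u) (group q K) <= 1)%N.
Proof.
rewrite -size_filter; set s := [seq x <- _ | _].
have us : uniq s by rewrite 2?filter_uniq ?enum_uniq.
have hs x : x \in s -> (x.1 < x.2)%N /\
    exists w : 'I_q, (u.+1 + w.+1 = K %[mod q]) /\
      (x = if (u < w)%N then (u, w) else (w, u)).
  rewrite !mem_filter /= => /and3P[/orP hu /andP[lt12 /eqP e] _].
  split=> //; case: hu => /eqP ->.
  - by exists x.2; rewrite lt12 -surjective_pairing.
  - exists x.1; rewrite addnC; split=> //.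
    by rewrite ltnNge (ltnW lt12) -surjective_pairing.
(* Both successors move onto u, so that u + 2 cancels modulo q and the reduced residues w and w'
   coincide. *)
have hinj (w w' : 'I_q) : u.+1 + w.+1 = K %[mod q] ->
    u.+1 + w'.+1 = K %[mod q] -> w = w'.
  move=> <- /eqP; rewrite -!addSnnS eqn_modDl => /eqP e; apply/val_inj.
  by rewrite -[LHS](modn_small (ltn_ord _)) -e modn_small.
case: s us hs => [//|x [//|y s]] /= /and3P[]; rewrite inE negb_or.
move=> /andP[/eqP xy _] _ _ hs; case: xy.
have [_ [w [ew ->]]] := hs x (mem_head _ _).
have [|_ [w' [ew' ->]]] := hs y; first by rewrite !inE eqxx orbT.
by rewrite (hinj w w' ew ew').
Qed.

Lemma count_group_meets_le (K : nat) p :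
  (count (meets p) (group q K) <= 2)%N.
Proof.
have := count_orb_le _ (fun x => pred2 x.1 x.2 p.1)
  (fun x => pred2 x.1 x.2 p.2) (group q K).
move/leq_trans; apply.
exact: leq_add (count_group_index_le _ _) (count_group_index_le _ _).
Qed.

Lemma uniq_others (I J : 'I_q) : uniq (others I J).
Proof. by rewrite filter_uniq ?enum_uniq. Qed.

Lemma size_others_le (I J : 'I_q) : (size (others I J) <= q)%N.
Proof.
by rewrite size_filter (leq_trans (count_size _ _)) // size_enum_ord.
Qed.

Lemma mem_cross p (I : 'I_q) Ks :
  p \in cross I Ks -> (p.1 == I) || (p.2 == I).
Proof.
by rewrite mem_cat => /orP[] /mapP[K _ ->] /=; rewrite eqxx ?orbT.
Qed.

(** The bound 12 is dictated by the exchange and update steps and shared by all six. Unfolded, the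
    claim is a Boolean formula in index equalities, checked on every truth assignment. *)
Lemma count_send_diag_blocks A p x :
  (count (involves p) (send_diag_blocks A x) <= meets p x * 12)%N.
Proof.
case: p x => u v [I J]; rewrite /meets /= !xpair_eqE.
by do !case: (_ == _).
Qed.

Lemma count_solve_subproblem (lk : kernels R) A p x :
  (count (involves p) (solve_subproblem lk A x) <= meets p x * 12)%N.
Proof.
case: p x => u v [I J]; rewrite /meets /= !xpair_eqE.
by do !case: (_ == _).
Qed.

Lemma count_send_results (lk : kernels R) A p x :
  (count (involves p) (send_results lk A x) <= meets p x * 12)%N.
Proof.
case: p x => u v [I J]; rewrite /send_results /meets /=.
case: (diag _ _) => V D /=; rewrite !xpair_eqE.
by do !case: (_ == _).
Qed.

(** The operations of index K can involve p only if K is its row or its column, and each occurs at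
    most once in [Ks]: hence the factor 2. *)
Lemma count_flatten_index_le (F : 'I_q -> step R q b) Ks p (t : bool) (k : nat) :
  uniq Ks ->
  (forall K, (count (involves p) (F K) <= pred2 p.1 p.2 K * (t * k))%N) ->
  (count (involves p) (flatten [seq F K | K <- Ks]) <= t * (2 * k))%N.
Proof.
move=> uKs hF; rewrite mulnCA.
apply: (@leq_trans (count (pred2 p.1 p.2) Ks * (t * k))).
  by apply: count_flatten_le => K _; apply: hF.
by rewrite leq_mul2r count_pred2_le ?orbT.
Qed.

Lemma count_exchange_blocks A Q p x :
  (count (involves p) (exchange_blocks A Q x) <= meets p x * 12)%N.
Proof.
(* For A, two relevant indices with at most 4 operations each; for Q, two with at most 2 each. *)
rewrite count_cat (mulnDr _ 8 4); apply: leq_add.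
- apply: (count_flatten_index_le _ _ _ (meets p x) 4) (uniq_others _ _) _ => K.
  (* Orienting the equalities alike makes both sides share the same Boolean atoms. *)
  case: p x => u v [I J]; rewrite /meets /= !xpair_eqE !(eq_sym K).
  by do !case: (_ == _).
- apply: (count_flatten_index_le _ _ _ (meets p x) 2) (enum_uniq _) _ => K.
  case: p x => u v [I J]; rewrite /meets /= !xpair_eqE !(eq_sym K).
  by do !case: (_ == _).
Qed.

Lemma count_update_blocks (lk : kernels R) p x :
  (count (involves p) (update_blocks lk b x) <= meets p x * 12)%N.
Proof.
rewrite count_cat (mulnDr _ 8 4); apply: leq_add.
- apply: (count_flatten_index_le _ _ _ (meets p x) 4) (uniq_others _ _) _ => K.
  case: p x => u v [I J]; rewrite /meets /= !xpair_eqE !(eq_sym K).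
  by do !case: (_ == _).
- apply: (count_flatten_index_le _ _ _ (meets p x) 2) (enum_uniq _) _ => K.
  case: p x => u v [I J]; rewrite /meets /= !xpair_eqE !(eq_sym K).
  by do !case: (_ == _).
Qed.

Lemma count_broadcast (r : proc q) Ks (X : seq 'M[R]_b) p :
  r.1 = r.2 ->
  (count (involves p) (broadcast r (cross r.1 Ks) X)
     <= ((p.1 == r.1) || (p.2 == r.1)))%N.
Proof.
case: r => I _ /= <-; rewrite /broadcast.
have := @mem_cross p I Ks; case: (cross I Ks) => [//|s ss] hp.
rewrite /= addn0.
case e : (_ || _) => //=; move: e; case/orP => [/eqP ->|/hp ->//].
by rewrite eqxx.
Qed.

Lemma count_broadcast_vectors (lk : kernels R) A p x :
  (count (involves p) (broadcast_vectors lk A x) <= meets p x * 12)%N.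
Proof.
case: x => I J; rewrite count_cat /=.
apply: leq_trans (leq_add (@count_broadcast (I, I) _ _ _ erefl)
  (@count_broadcast (J, J) _ _ _ erefl)) _.
by rewrite /meets /=; do !case: (_ == _).
Qed.

End Contention.

(** * Uniform bounds on steps, and the cost of a sweep *)

Section Program.
Context {R : realType} {q b : nat}.
Variables (lk : kernels R) (m : nat).
Hypothesis lk_diag : diagonalizes lk.
Hypothesis lk_update : (update_flops lk b <= m)%N.
Hypothesis lk_solve : forall X : 'M[R]_(b + b), X^T = X -> (diag_flops lk X <= m)%N.
Implicit Types (A Q : @blocks R q b) (x : proc q).

(* Every broadcast of a sweep is nonempty, which keeps log2 away from its junk
   value at 0; for q = 1 nothing is sent at all, as log2 P = 0 requires. *)
Definition op_bounded (o : op R q b) : bool :=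
  (1 < q)%N &&
  match o with
  | Send _ _ X => (size X <= 4)%N
  | Bcast _ ss X => (0 < size ss <= q + q)%N && (size X <= 2)%N
  | Local _ f => (f <= m)%N
  end.

Definition step_bounded (s : step R q b) : Prop :=
  (forall p, (count (involves p) s <= 24)%N) /\ all op_bounded s.

(** Any pair forces q to be at least 2, which supplies the first conjunct of [op_bounded]. *)
Lemma proc_lt_gt1 x : (x.1 < x.2)%N -> (1 < q)%N.
Proof. by move=> h; apply: leq_ltn_trans (ltn_ord x.2); case: (val x.2) h. Qed.

Lemma all_send_diag_blocks A x :
  (x.1 < x.2)%N -> all op_bounded (send_diag_blocks A x).
Proof. by move=> /proc_lt_gt1; rewrite /= /op_bounded => ->. Qed.

Lemma all_solve_subproblem A x : block_sym A ->
  (x.1 < x.2)%N -> all op_bounded (solve_subproblem lk A x).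
Proof.
move=> hA /proc_lt_gt1; rewrite /= /op_bounded => ->.
by rewrite lk_solve ?subproblem_sym.
Qed.

Lemma all_send_results A x :
  (x.1 < x.2)%N -> all op_bounded (send_results lk A x).
Proof.
move=> /proc_lt_gt1; rewrite /send_results /=.
by case: (diag _ _) => V D /=; rewrite /op_bounded => ->.
Qed.

Lemma all_exchange_blocks A Q x :
  (x.1 < x.2)%N -> all op_bounded (exchange_blocks A Q x).
Proof.
move=> /proc_lt_gt1 q1; rewrite all_cat; apply/andP; split;
  by apply: all_flatten_map => K _; rewrite /= /op_bounded q1.
Qed.

Lemma all_broadcast r (I J : 'I_q) (X : seq 'M[R]_b) : (1 < q)%N ->
  (size X <= 2)%N -> all op_bounded (broadcast r (cross r.1 (others I J)) X).
Proof.
move=> q1 hX; have := size_others_le I J; rewrite /broadcast.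
have : (size (cross r.1 (others I J)) = size (others I J) + size (others I J))%N.
  by rewrite size_cat !size_map.
case: cross => [//|s ss] hs hq.
by rewrite /= /op_bounded q1 hX /= -[_.+1]/(size (s :: ss)) hs leq_add.
Qed.

Lemma all_broadcast_vectors A x :
  (x.1 < x.2)%N -> all op_bounded (broadcast_vectors lk A x).
Proof.
case: x => I J /(proc_lt_gt1 (I, J)) q1; rewrite all_cat /=.
by rewrite (all_broadcast (I, I)) // (all_broadcast (J, J)).
Qed.

Lemma all_update_blocks x :
  (x.1 < x.2)%N -> all op_bounded (update_blocks lk b x).
Proof.
move=> /proc_lt_gt1 q1; rewrite all_cat; apply/andP; split;
  by apply: all_flatten_map => K _; rewrite /= /op_bounded q1 lk_update.
Qed.

Lemma step_bounded_group (K : nat) (F : proc q -> step R q b) :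
  (forall p x, (count (involves p) (F x) <= meets p x * 12)%N) ->
  (forall x, (x.1 < x.2)%N -> all op_bounded (F x)) ->
  step_bounded (flatten [seq F x | x <- group q K]).
Proof.
move=> hc ha; split=> [p|]; last first.
  by apply: all_flatten_map => x /group_lt; apply: ha.
apply: (@leq_trans (count (meets p) (group q K) * 12)).
  exact: count_flatten_le.
by rewrite (leq_mul2r 12 _ 2) count_group_meets_le.
Qed.

Lemma group_program_bounded (st : state R q b) (K t : nat) :
  block_sym st.1 ->
  step_bounded (nth [::] (group_program lk st (group q K)) t).
Proof.
case: st => A Q /= hA.
(* Past the sixth step [nth] returns the empty step, which satisfies every bound. *)
case: t => [|[|[|[|[|[|t]]]]]] /=; last by rewrite nth_nil; split.
- by apply: step_bounded_group => *;
    [apply: count_send_diag_blocks | apply: all_send_diag_blocks].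
- by apply: step_bounded_group => *;
    [apply: count_solve_subproblem | apply: all_solve_subproblem].
- by apply: step_bounded_group => *;
    [apply: count_send_results | apply: all_send_results].
- by apply: step_bounded_group => *;
    [apply: count_exchange_blocks | apply: all_exchange_blocks].
- by apply: step_bounded_group => *;
    [apply: count_broadcast_vectors | apply: all_broadcast_vectors].
- by apply: step_bounded_group => *;
    [apply: count_update_blocks | apply: all_update_blocks].
Qed.

(** Symmetry of A is the invariant carried from group to group, so the induction generalizes over
    the state. *)
Lemma run_bounded (st : state R q b) (Ks : seq nat) (t : nat) :
  block_sym st.1 ->
  step_bounded (nth [::] (run lk st [seq group q K | K <- Ks]) t).
Proof.
elim: Ks st t => [|K Ks IHK] st t hst; first by rewrite nth_nil; split.
rewrite nth_cat; case: ifP => _; first exact: group_program_bounded.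
by apply: IHK; apply: group_effect_sym.
Qed.

Lemma size_run (st : state R q b) gs : size (run lk st gs) = (6 * size gs)%N.
Proof.
elim: gs st => [//|g gs IHg] st.
by rewrite size_cat IHg mulnS; case: st.
Qed.

Lemma load_le (f : op R q b -> R) (B : R) (s : step R q b) p :
  0 <= B -> (forall o, op_bounded o -> f o <= B) -> step_bounded s ->
  load f s p <= 24 * B.
Proof.
move=> B0 hf [/(_ p) hc hs].
apply: (@le_trans _ _ ((count (involves p) s)%:R * B)); last first.
  by rewrite ler_wpM2r // ler_nat.
rewrite /load; elim: s hs {hc} => [|o s IHs] /=; first by rewrite big_nil mul0r.
case/andP=> ho /IHs hs; rewrite big_cons natrD mulrDl.
by case: ifP => _; rewrite ?mul1r ?mul0r ?add0r // lerD // hf.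
Qed.

Lemma sweep_cost_le (f : op R q b -> R) (B : R) (A Q : 'M[R]_(q * b)) :
  A^T = A -> 0 <= B -> (forall o, op_bounded o -> f o <= B) ->
  along_critical_path f (jacobi_sweep lk A Q) <= 144 * (q%:R * B).
Proof.
move=> hA B0 hf; set pr := jacobi_sweep _ _ _.
have hpr t : step_bounded (nth [::] pr t).
  by apply: run_bounded; apply: block_sym_blocks_of.
have sz : size pr = (6 * q)%N by rewrite size_run size_map size_iota.
(* The maximum over chains starts from 0, so the bound must be nonnegative. The constant is 144 = 6
   * 24: six steps per group, 24 operations per step. *)
have C0 : 0 <= 144 * (q%:R * B) by rewrite !mulr_ge0.
apply: (big_ind (fun y => y <= 144 * (q%:R * B))) => // [y z hy hz|c _].
  by rewrite ge_max hy hz.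
apply: (@le_trans _ _ (\sum_(t < size pr) 24 * B)).
  by apply: ler_sum => t _; apply: load_le.
rewrite sumr_const card_ord sz -[_ *+ (6 * q)]mulr_natl natrM.
by rewrite le_eqVlt; apply/orP; left; apply/eqP; ring.
Qed.

End Program.

(** * Estimates for the binary logarithm *)

Section Communication.
Context {R : realType}.

(** Lets the constant message count of a send be absorbed into log q. *)
Lemma log2_ge1 (k : nat) : (1 < k)%N -> 1 <= log2 (k%:R : R).
Proof.
move=> k1; have l2 : 0 < ln 2 :> R by rewrite ln_gt0 // ltr1n.
rewrite /log2 ler_pdivlMr // mul1r ler_ln ?posrE ?ltr0n ?ler_nat //.
exact: leq_trans k1.
Qed.

Lemma log2_square (k : nat) : (0 < k)%N ->
  log2 ((k ^ 2)%:R : R) = 2 * log2 k%:R.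
Proof.
move=> k0; rewrite /log2 -mulnn natrM lnM ?posrE ?ltr0n //.
by rewrite mulrDl -mulr2n mulr_natl.
Qed.

Lemma le_log2 (k l : nat) : (0 < k <= l)%N -> log2 (k%:R : R) <= log2 l%:R.
Proof.
case/andP=> k0 kl; have l2 : 0 < ln 2 :> R by rewrite ln_gt0 // ltr1n.
rewrite /log2 ler_pM2r ?invr_gt0 // ler_ln ?posrE ?ltr0n ?ler_nat //.
exact: leq_trans kl.
Qed.

End Communication.


(** * The three asymptotic bounds *)

Theorem theorem1 (R : realType) (M : comm_model R) (lk : kernels R)
  (hM : comm_costs M) (hdiag : diagonalizes lk)
  (hmm3 : cubic_mm lk) (hdiag3 : cubic_diag lk) :
  exists C : R,
  forall (n P q b : nat) (hn : (0 < n)%N) (hP : P = (q ^ 2)%N)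
    (hnb : n = (q * b)%N) (A Q : 'M[R]_n)
    (hA : A^T = A) (hQ : Q^T *m Q = 1%:M),
  let sweep := jacobi_sweep lk (castmx (hnb, hnb) A) (castmx (hnb, hnb) Q) in
  [/\ S_cost M sweep <= C * (Num.sqrt P%:R * log2 P%:R),
      W_cost M sweep <= C * (n%:R ^+ 2 / Num.sqrt P%:R)
    & F_cost sweep <= C * (n%:R ^+ 3 / P%:R)].
Proof.
case: hM => c [hsm hsw hbig hsmall]; case: hmm3 => cm hcm; case: hdiag3 => cd hcd.
have c0 : 0 <= c by have /andP[h1 h2] := hsm 0; apply: le_trans h2.
(* An update costs two products and an addition, with b ^ 2 <= b ^ 3; a subproblem has size 2 b,
   whence the factor 8 = 2 ^ 3. *)
pose cf := (2 * cm + 1 + 8 * cd)%N.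
exists (144 * (4 * c + 4 + cf%:R)) => n P q b hn hP hnb A Q hA _ sweep.
have [q0 b0] : (0 < q)%N /\ (0 < b)%N.
  by apply/andP; rewrite -muln_gt0 -hnb.
have hA' : (castmx (hnb, hnb) A)^T = castmx (hnb, hnb) A by rewrite trmx_cast hA.
have hup : (update_flops lk b <= cf * b ^ 3)%N.
  rewrite /update_flops /cf 2!mulnDl mul1n -addnA; apply: leq_add.
    by rewrite -mulnA leq_mul2l hcm.
  by rewrite (leq_trans (leq_pexp2l b0 (isT : (2 <= 3)%N))) // leq_addr.
have hso (X : 'M[R]_(b + b)) : X^T = X -> (diag_flops lk X <= cf * b ^ 3)%N.
  move=> hX; apply: leq_trans (hcd _ X hX) _.
  by rewrite addnn -mul2n expnMn mulnA /cf mulnDl (mulnC cd) leq_addl.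
have cost := @sweep_cost_le R q b lk _ hdiag hup hso.
have sqP : Num.sqrt P%:R = q%:R :> R by rewrite hP natrX sqrtr_sqr ger0_norm.
have qn0 : q%:R != 0 :> R by rewrite pnatr_eq0 -lt0n.
have cf0 : 0 <= cf%:R :> R by [].
have log0 : 0 <= log2 (q%:R : R).
  have -> : 0 = log2 (1%:R : R) by rewrite /log2 ln1 mul0r.
  by rewrite le_log2.
(* A broadcast has at most 2 q recipients, and 2 q <= q ^ 2. *)
have logqq : (1 < q)%N -> log2 ((q + q)%:R : R) <= 2 * log2 q%:R.
  move=> q1; rewrite -log2_square // le_log2 // addn_gt0 q0 /=.
  by rewrite addnn -mul2n -mulnn leq_mul2r q1 orbT.
have le_bcast_log k : (0 < k <= q + q)%N -> (1 < q)%N ->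
    log2 (k%:R : R) <= 2 * log2 q%:R.
  by move=> hk q1; apply: le_trans (le_log2 _ _ hk) (logqq q1).
have clog0 := mulr_ge0 c0 log0.
have b20 := ler0n R (b ^ 2); have cb20 := mulr_ge0 c0 b20.
have hw k (X : seq 'M[R]_b) : (size X <= k)%N ->
    (nwords X)%:R <= k%:R * (b ^ 2)%:R :> R.
  by move=> hX; rewrite -natrM ler_nat leq_mul2r hX orbT.
(* The factor k is 2 for messages, since log P = 2 log q, and 1 for words and flops. *)
have const_le (a k t : R) : 0 <= t -> a <= k * (4 * c + 4 + cf%:R) ->
    144 * (a * t) <= 144 * (4 * c + 4 + cf%:R) * (k * t).
  move=> t0 ha; rewrite -mulrA ler_pM2l // mulrA ler_wpM2r //.
  by rewrite mulrC.
split.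
- rewrite sqP hP log2_square //.
  (* With at most 2 q recipients, a broadcast costs at most 4 log q messages in the exact regime and
     2 c log q in the other; a send costs at most c. *)
  apply: le_trans (cost _ ((2 * c + 4) * log2 q%:R) _ _ hA' _ _) _.
  + by rewrite mulr_ge0 // addr_ge0 // mulr_ge0.
  + case=> [r s X|r ss X|r f] /andP[q1] /= ho.
    * have /andP[_ h] := hsm (nwords X).
      have h1 := ler_wpM2l c0 (log2_ge1 _ q1); rewrite /op_msgs; lra.
    * have [hss _] := andP ho; have hl := le_bcast_log _ hss q1.
      have [ss0 _] := andP hss; have hcl := ler_wpM2l c0 hl.
      rewrite /op_msgs; have [le|lt] := leqP (size ss) (nwords X).
        have [|-> _] := hbig (size ss) (nwords X); first by rewrite ss0.
        lra.
      have [/andP[_ h] _] := hsmall _ _ lt; lra.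
    * by rewrite mulr_ge0 // addr_ge0 // mulr_ge0.
  + rewrite [X in 144 * X <= _]mulrCA [X in _ <= _ * X]mulrCA.
    by apply: const_le; [rewrite mulr_ge0 | lra].
- rewrite sqP.
  (* A send carries at most 4 blocks; a broadcast carries at most 2, at 2 words or c words per
     entry. *)
  apply: le_trans (cost _ ((4 * c + 4) * (b ^ 2)%:R) _ _ hA' _ _) _.
  + by rewrite mulr_ge0 // addr_ge0 // mulr_ge0.
  + case=> [r s X|r ss X|r f] /andP[q1] /= ho.
    * have hX := ler_wpM2l c0 (hw _ _ ho).
      have /andP[_ h] := hsw (nwords X); rewrite /op_words; lra.
    * have [/andP[ss0 _] /hw hX] := andP ho; have hcX := ler_wpM2l c0 hX.
      rewrite /op_words; have [le|lt] := leqP (size ss) (nwords X).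
        have [|_ ->] := hbig (size ss) (nwords X); first by rewrite ss0.
        lra.
      have [_ /andP[_ h]] := hsmall _ _ lt; lra.
    * by rewrite mulr_ge0 // addr_ge0 // mulr_ge0.
  + have -> : n%:R ^+ 2 / q%:R = 1 * (q%:R * (b ^ 2)%:R) :> R.
      by rewrite hnb natrM natrX; field.
    by rewrite [q%:R * _]mulrCA; apply: const_le; [rewrite mulr_ge0 | lra].
- apply: le_trans (cost _ (cf%:R * (b ^ 3)%:R) _ _ hA' _ _) _.
  + by rewrite mulr_ge0.
  + case=> [r s X|r ss X|r f] /andP[q1] /= ho; rewrite ?mulr_ge0 //.
    by rewrite -natrM ler_nat.
  + have -> : n%:R ^+ 3 / P%:R = 1 * (q%:R * (b ^ 3)%:R) :> R.
      by rewrite hP hnb natrM !natrX; field.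
    by rewrite [q%:R * _]mulrCA; apply: const_le; [rewrite mulr_ge0 | lra].
Qed.
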